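(* For all integers $j,k\ge2$ with $j\neq k$ and all integers $m\ge1$, $n\ge1$, $$G(m\vec j+n\vec k)=\sum_{i=0}^{n}(-1)^i\,C\big((m+1+i)\vec j+(n-i)\vec k\big).$$
   Context: A type is a vector $\mathbf m=[m_2,m_3,\ldots]$ of natural numbers (indices start at $2$) with finitely many nonzero entries; $\vec j$ is the type with $1$ in position $j$ and $0$ elsewhere, and $\mathbf t^{\mathbf m}=t_2^{m_2}t_3^{m_3}\cdots$. The hyper-Catalan number is $C(\mathbf m)=C_{\mathbf m}=\frac{(2m_2+3m_3+4m_4+\cdots)!}{(1+m_2+2m_3+3m_4+\cdots)!\,m_2!\,m_3!\cdots}$ and $\mathbf S=\sum_{\mathbf m}C_{\mathbf m}\mathbf t^{\mathbf m}$. The Geode $\mathbf G$ is the unique formal power series with $\mathbf S-1=(t_2+t_3+t_4+\cdots)\mathbf G$, and $G(\mathbf n)$ is its coefficient of $\mathbf t^{\mathbf n}$. *)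

(* Defs.v *)
From mathcomp Require Import all_boot all_order all_algebra finmap multiset.
From mathcomp Require Import boolp classical_sets functions cardinality fsbigop.

Set Implicit Arguments.
Unset Strict Implicit.
Unset Printing Implicit Defensive.

Import GRing.Theory.
Local Open Scope ring_scope.

Definition tindex : choiceType := {j : nat | (2 <= j)%N}.

(* A type [m_2, m_3, ...] is the finitely supported function j |-> m_j, i.e. a
   multiset of indices: [msetn m j] is m times the unit type at j, and [`+`]
   is the entrywise sum. *)
Definition mtype : choiceType := {mset tindex}%mset.

Definition hyperCatalan (m : mtype) : rat :=
  ((\sum_(j <- finsupp m) val j * m j)`!)%N%:R /
  ((1 + \sum_(j <- finsupp m) (val j).-1 * m j)`! *
     \prod_(j <- finsupp m) (m j)`!)%N%:R.

(* Formal power series in t_2, t_3, ..., as families of coefficients. *)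
Definition fps := mtype -> rat.

Definition fps_one : fps := fun m => (m == mset0)%:R.

Definition fps_var (j : tindex) : fps := fun m => (m == [mset j]%mset)%:R.

(* t_2 + t_3 + ...; at each m at most one summand is nonzero. *)
Definition fps_vars : fps :=
  fun m => \sum_(j \in [set: tindex]%classic) fps_var j m.

Definition splits (m : mtype) : set (mtype * mtype) :=
  [set p | (p.1 `+` p.2)%mset = m]%classic.

(* Guarantees that the finitely supported sum in [fps_mul] never falls back
   on its default value 0. *)
Lemma finite_splits (m : mtype) : finite_set (splits m).
Proof.
pose n := (\sum_(j <- finsupp m) m j)%N.
pose dec (f : {ffun finsupp m -> 'I_n.+1}) : mtype :=
  [fsfun j in finsupp m => if insub j is Some u then f u : nat else 0%N].
have le_n j : (m j <= n)%N.
  case: (finsuppP m j) => [//|jm].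
  by rewrite /n (big_fsetD1 j) //= leq_addr.
have decP (a : mtype) : (forall j, a j <= m j)%N -> exists f, dec f = a.
  move=> le_am; exists [ffun j => inord (a (val j))]; apply/fsfunP => j.
  rewrite /dec fsfunE; case: ifPn => [jm|jm].
    by rewrite insubT ffunE inordK // ltnS (leq_trans (le_am _)).
  by move: (le_am j); rewrite (fsfun_dflt jm) leqn0 => /eqP ->.
apply: (@sub_finite_set _ _
  ((fun q => (dec q.1, dec q.2)) @` setT)%classic); last first.
  exact/finite_image/finite_finset.
move=> [a b] /= ab.
have abE j : m j = (a j + b j)%N by rewrite -ab msetE2.
have [f fa] : exists f, dec f = a.
  by apply: decP => j; rewrite abE leq_addr.
have [g gb] : exists g, dec g = b.
  by apply: decP => j; rewrite abE leq_addl.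
by exists (f, g) => //=; rewrite fa gb.
Qed.

Definition fps_mul (f g : fps) : fps :=
  fun m => \sum_(p \in splits m) f p.1 * g p.2.

(* The generating series S of the hyper-Catalan numbers is [hyperCatalan]
   itself, so this reads S - 1 = (t_2 + t_3 + ...) G, which determines G. *)
Definition is_geode (G : fps) : Prop :=
  hyperCatalan \- fps_one =1 fps_mul fps_vars G.

(* Main.v *)
(* At a nonzero type m, comparing coefficients in S - 1 = (t_2 + t_3 + ...) G
   says that C(m) is the sum of G(m - x) over the indices x occurring in m.  On
   types with entries only at j and k this reads
   C(a, b) = G(a - 1, b) + G(a, b - 1), so G(m, n) = C(m + 1, n) - G(m + 1, n - 1),
   which unfolds down to G(m, 0) = C(m + 1, 0). *)
Require Import Defs.
From mathcomp Require Import boolp fsbigop.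
From mathcomp Require Import all_boot all_order all_algebra finmap multiset.

Import GRing.Theory.
Local Open Scope ring_scope.

Lemma fps_vars1 (x : tindex) : fps_vars [mset x]%mset = 1.
Proof.
rewrite /fps_vars (fsbigTE [fset x]%fset) => [|y]; last first.
  rewrite inE /fps_var => neq_yx; case: eqP => // /msetn_inj xy.
  by rewrite xy ?eqxx in neq_yx.
by rewrite big_seq_fset1 /fps_var eqxx.
Qed.

Lemma fps_vars_neq0 (m : mtype) :
  fps_vars m != 0 -> exists x, m = [mset x]%mset.
Proof.
apply: contra_neqP => nx; apply: fsbig1 => x _.
by rewrite /fps_var; case: eqP => // mx; case: nx; exists x.
Qed.

(** A split [(a, b)] of [m] contributes only if [a] is a single index [x]; then [x] occurs in [m]
    and [b] is [m] with one [x] removed. So [h] maps the support of [m] injectively onto the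
    contributing splits. *)
Lemma fps_mul_vars (G : fps) (m : mtype) :
  fps_mul fps_vars G m = \sum_(x <- finsupp m) G (m `\ x)%mset.
Proof.
pose h x : mtype * mtype := ([mset x]%mset, (m `\ x)%mset).
have h_inj : injective h by move=> x y [/msetn_inj ->].
rewrite /fps_mul (fsbigE (map h (finsupp m))).
- rewrite big_map big_seq_cond [RHS]big_seq; apply: eq_big => [x|x _].
    case xm: (x \in finsupp m) => //=; apply/asboolP.
    by rewrite /splits /h /= msetB1K // -msuppE.
  by rewrite /= fps_vars1 mul1r.
- by rewrite map_inj_uniq.
- move=> _ /= /mapP[x xm ->].
  by rewrite /splits /h /= msetB1K // -msuppE.
(* By contraposition: a nonzero term makes [a] a single index, so the split lies in the image of
   [h]. *)
move=> [a b] /= abm; apply: contraNeq; rewrite mulf_eq0 negb_or => /andP[].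
move=> /fps_vars_neq0[x ax] _; rewrite /splits /= ax in abm; subst a m.
by apply/mapP; exists x; rewrite ?msuppE ?mset1D1 // /h msetD1K.
Qed.

Lemma geode_rec (G : fps) (m : mtype) : is_geode G -> m != mset0 ->
  hyperCatalan m = \sum_(x <- finsupp m) G (m `\ x)%mset.
Proof.
move=> geodeG m0; rewrite -fps_mul_vars -geodeG /= /fps_one.
by rewrite (negPf m0) subr0.
Qed.

Lemma msetnSB1 (T : choiceType) (n : nat) (x : T) :
  (msetn n.+1 x `\ x = msetn n x)%mset.
Proof.
by apply/msetP => y; rewrite msetB1E !msetnE; case: eqP; rewrite ?subn1.
Qed.

Lemma geode_rec1 (G : fps) (j : tindex) (m : nat) : is_geode G ->
  hyperCatalan (msetn m.+1 j) = G (msetn m j).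
Proof.
move=> geodeG; rewrite (geode_rec _ _ geodeG).
  by rewrite finsupp_msetn big_seq_fset1 msetnSB1.
by apply/eqP => /msetP/(_ j); rewrite msetnxx mset0E.
Qed.

Lemma geode_rec2 (G : fps) (j k : tindex) (m n : nat) :
  is_geode G -> j != k ->
  hyperCatalan (msetn m.+1 j `+` msetn n.+1 k)%mset =
  G (msetn m j `+` msetn n.+1 k)%mset + G (msetn m.+1 j `+` msetn n k)%mset.
Proof.
move=> geodeG neq_jk; set M := (_ `+` _)%mset.
have suppM : finsupp M = [fset j; k]%fset.
  by apply/fsetP => x; rewrite msuppE in_msetD !in_msetn !inE.
rewrite (geode_rec _ _ geodeG); last first.
  by apply/eqP => /msetP/(_ j); rewrite msetE2 msetnxx mset0E.
rewrite suppM big_fsetU1 ?inE //= big_seq_fset1.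
(* [msetDBA] moves the removal into the right summand, so only the copy of [M] that loses [j] is
   commuted first. *)
rewrite {1}/M msetDC -!msetDBA ?msub1set ?msetn1 // !msetnSB1.
by rewrite msetDC.
Qed.

(** Induction on [n] from [0], with [m] general because each step of the recurrence raises it by
    one. *)
Lemma geode_alternating_sum (G : fps) (j k : tindex) (m n : nat) :
  is_geode G -> j != k ->
  G (msetn m j `+` msetn n k)%mset =
    \sum_(0 <= i < n.+1)
      (-1) ^+ i * hyperCatalan (msetn (m + 1 + i)%N j `+` msetn (n - i)%N k)%mset.
Proof.
move=> geodeG neq_jk; elim: n m => [|n IHn] m.
  rewrite big_nat1 expr0 mul1r subn0 addn0 addn1 !msetn0 !msetD0.
  by rewrite (geode_rec1 _ _ _ geodeG).
rewrite big_nat_recl // expr0 mul1r subn0 addn0 addn1.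
(* The leading hyper-Catalan number splits into the desired coefficient and the one at [(m.+1, n)];
   expanded by induction, the latter cancels the remaining sum term by term. *)
rewrite (geode_rec2 _ _ _ _ _ geodeG neq_jk) IHn -addrA -big_split
  big1 ?addr0 //= => i _.
by rewrite exprS mulN1r mulNr subSS addn1 addSnnS subrr.
Qed.

Theorem theorem11 (G : fps) (geodeG : is_geode G)
    (j k : tindex) (neq_jk : j <> k) (m n : nat)
    (m_ge1 : (1 <= m)%N) (n_ge1 : (1 <= n)%N) :
  G (msetn m j `+` msetn n k)%mset =
    \sum_(0 <= i < n.+1)
      (-1) ^+ i *
      hyperCatalan (msetn (m + 1 + i)%N j `+` msetn (n - i)%N k)%mset.
Proof. exact/geode_alternating_sum/eqP. Qed.
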